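(* Let $C_\infty:\ell^\infty\to\ell^\infty$ be the Cesàro operator $C_\infty(x)=\left(\frac1n\sum_{k=1}^n x_k\right)_{n=1}^\infty$, $x=(x_n)_{n=1}^\infty\in\ell^\infty$, which is a positive operator belonging to $\mathcal{L}(\ell^\infty)$. Then its order spectrum coincides with its spectrum, that is, $\sigma_{\rm o}(C_\infty)=\sigma(C_\infty)$.
   Context: $\mathbb{N}=\{1,2,\ldots\}$. $\ell^\infty$ is the complex Banach lattice of bounded sequences in $\mathbb{C}^{\mathbb{N}}$ with the supremum norm and the coordinatewise order. For a complex Banach lattice $E$, $\mathcal{L}(E)$ is the unital Banach algebra of all continuous linear operators $E\to E$ (unit: the identity $I$). The spectrum of $T\in\mathcal{L}(E)$ is $\sigma(T)=\{\lambda\in\mathbb{C}:\lambda I-T \text{ is not invertible in }\mathcal{L}(E)\}$. An operator $T\in\mathcal{L}(E)$ is regular if it is a finite (complex) linear combination of positive operators; $\mathcal{L}^r(E)$ denotes the set of all regular operators, which is a unital algebra (a Banach algebra for the norm $\|T\|_r=\inf\{\|S\|_{\rm op}:S\in\mathcal{L}(E),\,S\ge0,\,|T(z)|\le S(|z|)\ \forall z\in E\}$). The order spectrum of $T\in\mathcal{L}^r(E)$ is $\sigma_{\rm o}(T)=\{\lambda\in\mathbb{C}:\lambda I-T\text{ is not invertible in }\mathcal{L}^r(E)\}$. *)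

(* Defs.v *)
From HB Require Import structures.
From mathcomp Require Import all_boot all_order all_algebra.
From mathcomp Require Import complex.
From mathcomp Require Import all_classical all_reals all_analysis.

Set Implicit Arguments.
Unset Strict Implicit.
Unset Printing Implicit Defensive.

Import Order.TTheory GRing.Theory Num.Theory.
Import numFieldNormedType.Exports.

Local Open Scope classical_set_scope.
Local Open Scope ring_scope.
Local Open Scope complex_scope.

Section Spectrum.
Context {K : numFieldType} {E : normedModType K}.
Implicit Types (A : set (E -> E)) (S T : E -> E) (l : K).

Definition bounded_operator : set (E -> E) :=
  [set T | linear T /\ continuous T].

Definition invertible_in A T :=
  exists2 S, A S & (forall x, S (T x) = x) /\ (forall x, T (S x) = x).

Definition spectrum_in A T : set K :=
  [set l | ~ invertible_in A (fun x => l *: x - T x)].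

Definition spectrum T := spectrum_in bounded_operator T.

End Spectrum.

Section Linf.
Variable R : realType.

Definition bounded_seq : {pred nat -> R[i]} :=
  fun x => `[< exists M : R, forall n, `|x n| <= M%:C >].

(* Bounded complex sequences, shifted: the term of index [n] is the (n+1)-st term
   of a sequence indexed from 1. *)
Record linf := Linf { linf_val :> nat -> R[i]; _ : linf_val \in bounded_seq }.

HB.instance Definition _ := [isSub for linf_val].
HB.instance Definition _ := [Choice of linf by <:].

Lemma bounded_seqP (x : nat -> R[i]) :
  reflect (exists M : R, forall n, `|x n| <= M%:C) (x \in bounded_seq).
Proof. exact: asboolP. Qed.

Lemma bounded_seq_submod : submod_closed bounded_seq.
Proof.
split; first by apply/bounded_seqP; exists 0 => n; rewrite normr0.
move=> a x y /bounded_seqP[M xM] /bounded_seqP[N yN]; apply/bounded_seqP.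
exists (Normc.normc a * M + N) => n; rewrite rmorphD rmorphM/=.
apply: le_trans (ler_normD _ _) _; apply: lerD => //.
by rewrite normrM ler_wpM2l.
Qed.

HB.instance Definition _ :=
  GRing.isSubmodClosed.Build R[i] (nat -> R[i]) bounded_seq bounded_seq_submod.
HB.instance Definition _ := [SubChoice_isSubLmodule of linf by <:].

Definition linf_norm (x : linf) : R[i] := (sup (range (fun n => Normc.normc (x n))))%:C.

Lemma linf_has_sup (x : linf) : has_sup (range (fun n => Normc.normc (x n))).
Proof.
split; first by exists (Normc.normc (x 0)), 0.
have /bounded_seqP[M xM] := valP x; exists M => _ [n _ <-].
by rewrite -lecR; exact: xM.
Qed.

Lemma linf_norm_ge (x : linf) n : `|x n| <= linf_norm x.
Proof.
by rewrite lecR; apply: ub_le_sup; [case: (linf_has_sup x)|exists n].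
Qed.

Lemma linf_norm_le (x : linf) (M : R) :
  (forall n, `|x n| <= M%:C) -> linf_norm x <= M%:C.
Proof.
move=> xM; rewrite lecR; apply: ge_sup; first by case: (linf_has_sup x).
by move=> _ [n _ <-]; rewrite -lecR; exact: xM.
Qed.

Lemma linf_ler_normD x y : linf_norm (x + y) <= linf_norm x + linf_norm y.
Proof.
rewrite -rmorphD; apply: linf_norm_le => n; rewrite rmorphD.
by apply: le_trans (ler_normD _ _) _; apply: lerD; exact: linf_norm_ge.
Qed.

Lemma linf_normrZ (l : R[i]) x : linf_norm (l *: x) = `|l| * linf_norm x.
Proof.
have le_normZ (a : R[i]) (y : linf) : linf_norm (a *: y) <= `|a| * linf_norm y.
  rewrite -rmorphM; apply: linf_norm_le => n; rewrite rmorphM.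
  by rewrite normrM; apply: ler_wpM2l => //; exact: linf_norm_ge.
apply/le_anti; rewrite le_normZ /=; have [->|l0] := eqVneq l 0.
  rewrite normr0 mul0r; apply: le_trans (linf_norm_ge _ 0); exact: normr_ge0.
rewrite mulrC -ler_pdivlMr ?normr_gt0//.
have := le_normZ l^-1 (l *: x).
by rewrite scalerA mulVf// scale1r normfV mulrC.
Qed.

Lemma linf_normr0_eq0 x : linf_norm x = 0 -> x = 0.
Proof.
move=> x0; apply: val_inj; apply/funext => n; apply/normr0_eq0/le_anti.
by rewrite normr_ge0 andbT -x0 linf_norm_ge.
Qed.

HB.instance Definition _ := Lmodule_isNormed.Build R[i] linf
  linf_ler_normD linf_normrZ linf_normr0_eq0.

(* In R[i], [0 <= z] means that z is real and nonnegative. *)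
Definition linf_nonneg (x : linf) := forall n, 0 <= x n.

Definition positive_operator (T : linf -> linf) :=
  bounded_operator T /\ forall x, linf_nonneg x -> linf_nonneg (T x).

Definition regular_operator : set (linf -> linf) :=
  [set T | bounded_operator T /\
    exists (m : nat) (a : 'I_m -> R[i]) (P : 'I_m -> linf -> linf),
      (forall i, positive_operator (P i)) /\
      (forall x, T x = \sum_(i < m) a i *: P i x)].

Definition order_spectrum (T : linf -> linf) : set R[i] :=
  spectrum_in regular_operator T.

Definition cesaro_seq (x : nat -> R[i]) : nat -> R[i] :=
  fun n => n.+1%:R^-1 * \sum_(k < n.+1) x k.

Lemma cesaro_bounded (x : linf) : cesaro_seq x \in bounded_seq.
Proof.
have /bounded_seqP[M xM] := valP x; apply/bounded_seqP; exists M => n.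
rewrite normrM normfV normr_nat mulrC ler_pdivrMr ?ltr0n//.
apply: le_trans (ler_norm_sum _ _ _) _.
apply: (@le_trans _ _ (\sum_(k < n.+1) M%:C)); first by apply: ler_sum => k _.
by rewrite sumr_const card_ord mulr_natr.
Qed.

Definition cesaro_op (x : linf) : linf := Linf (cesaro_bounded x).

End Linf.

(* Main.v *)
(* Every bounded operator T on l^oo is regular, so the two algebras in which
   invertibility is tested coincide. Indeed l^oo is Dedekind complete and each
   order interval [0, x] is norm bounded, so T maps it to a norm bounded, hence
   order bounded, set; coordinatewise suprema of Re T over [0, x] therefore exist,
   and by the Riesz decomposition property they are additive in x >= 0. Their
   linear extension is a positive operator dominating Re T on the positive cone,
   which writes Re T as a difference of positive operators there; applying this to
   T and to -iT gives T = P1 - P2 + i(P3 - P4). *)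
From HB Require Import structures.
Require Import Defs.
From mathcomp Require Import all_boot all_order all_algebra.
From mathcomp Require Import complex.
From mathcomp Require Import all_classical all_reals all_analysis.
From mathcomp Require Import ring lra.

Set Implicit Arguments.
Unset Strict Implicit.
Unset Printing Implicit Defensive.

Import Order.TTheory GRing.Theory Num.Theory.
Import numFieldNormedType.Exports.

Local Open Scope classical_set_scope.
Local Open Scope ring_scope.
Local Open Scope complex_scope.

Section Linf.
Variable R : realType.
Implicit Types (x y z a b c d : linf R) (P T : linf R -> linf R).

(** * Coordinatewise algebra, order and norm on [linf R] *)

Lemma linf_ext x y : (forall n, x n = y n) -> x = y.
Proof. by move=> xy; apply: val_inj; apply/funext. Qed.

Lemma max0B (r : R) : Num.max r 0 - Num.max (- r) 0 = r.
Proof. by rewrite !maxEle; do 2 case: ifP => ?; lra. Qed.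

Lemma linfD x y n : (x + y) n = x n + y n. Proof. by []. Qed.
Lemma linfN x n : (- x) n = - x n. Proof. by []. Qed.
Lemma linfZ (l : R[i]) x n : (l *: x) n = l * x n. Proof. by []. Qed.

Let linfE := (linfD, linfN, linfZ).

Lemma linf_norm_geE x n : `|x n| <= `|x|. Proof. exact: linf_norm_ge. Qed.

Lemma linf_norm_leE x (M : R) : (forall n, `|x n| <= M%:C) -> `|x| <= M%:C.
Proof. exact: linf_norm_le. Qed.

Lemma linf_normE x : `|x| = (complex.Re `|x|)%:C. Proof. by []. Qed.

Lemma linf_nonnegD x y : linf_nonneg x -> linf_nonneg y -> linf_nonneg (x + y).
Proof. by move=> x0 y0 n; rewrite linfD addr_ge0. Qed.

Lemma linf_nonnegZ (r : R) x : 0 <= r -> linf_nonneg x -> linf_nonneg (r%:C *: x).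
Proof. by move=> r0 x0 n; rewrite linfZ mulr_ge0// ler0c. Qed.

Lemma Re_nonneg x n : linf_nonneg x -> x n = (complex.Re (x n))%:C.
Proof. by move=> /(_ n); case: (x n) => u v; rewrite lecE /= => /andP[/eqP -> _]. Qed.

(** * Decomposition of a vector into four nonnegative parts *)

Lemma pos_re_bounded x :
  (fun n => (Num.max (complex.Re (x n)) 0)%:C) \in @bounded_seq R.
Proof.
apply/bounded_seqP; exists (complex.Re `|x|) => n; rewrite -linf_normE.
apply: le_trans (linf_norm_geE x n); apply: le_trans (normc_ge_Re _).
by rewrite ger0_norm ?lecR ?ler0c ?le_max ?lexx ?orbT// ge_max ler_norm normr_ge0.
Qed.

Definition pos_re x : linf R := Linf (pos_re_bounded x).

Lemma pos_re_nonneg x : linf_nonneg (pos_re x).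
Proof. by move=> n; rewrite ler0c le_max lexx orbT. Qed.

Lemma pos_reE x n : pos_re x n = (Num.max (complex.Re (x n)) 0)%:C.
Proof. by []. Qed.

(** Common shape for the decomposition of vectors and of operator values: the real part as [a - b],
    the imaginary part as [c - d] when all four are nonnegative. *)
Definition comb a b c d := a - b + 'i *: (c - d).

(** Since Re (-iz) = Im z, the last two components are the positive and negative parts of Im x. *)
Lemma comb_pos_re x :
  x = comb (pos_re x) (pos_re (- x)) (pos_re (- 'i *: x)) (pos_re ('i *: x)).
Proof.
apply: linf_ext => n; rewrite /comb !(linfE, pos_reE).
case: (x n) => u v /=; apply/eqP; rewrite eq_complex /=.
have -> : - 0 * u - -1 * v = v by ring.
have -> : 0 * u - 1 * v = - v by ring.
apply/andP; split; apply/eqP; rewrite !(mul0r,mul1r,subr0,addr0,oppr0,mulr0,add0r).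
  by rewrite max0B.
by rewrite max0B.
Qed.

(** The vector fixes only the differences of its components. They are compared through sums, which
    stay in the cone, where a map additive only on the cone can be applied. *)
Lemma nonneg_comb_inj a b c d a' b' c' d' :
  linf_nonneg a -> linf_nonneg b -> linf_nonneg c -> linf_nonneg d ->
  linf_nonneg a' -> linf_nonneg b' -> linf_nonneg c' -> linf_nonneg d' ->
  comb a b c d = comb a' b' c' d' -> a + b' = a' + b /\ c + d' = c' + d.
Proof.
move=> a0 b0 c0 d0 a0' b0' c0' d0' E.
have En n : a n + b' n = a' n + b n /\ c n + d' n = c' n + d n.
  have := congr1 (fun x => x n) E; rewrite /comb !linfE.
  rewrite (Re_nonneg n a0) (Re_nonneg n b0) (Re_nonneg n c0) (Re_nonneg n d0).
  rewrite (Re_nonneg n a0') (Re_nonneg n b0') (Re_nonneg n c0') (Re_nonneg n d0').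
  move=> /eqP; rewrite eq_complex /= => /andP[/eqP e1 /eqP e2].
  by split; rewrite -!rmorphD/=; congr (_%:C); lra.
by split; apply: linf_ext => n; rewrite !linfE; case: (En n).
Qed.

(** * Linear extension from the positive cone *)

Section Extension.
Variable Q : linf R -> linf R.
Hypothesis QD : forall x y, linf_nonneg x -> linf_nonneg y -> Q (x + y) = Q x + Q y.
Hypothesis QZ : forall (r : R) x, 0 <= r -> linf_nonneg x -> Q (r%:C *: x) = r%:C *: Q x.

Definition cone_ext x :=
  comb (Q (pos_re x)) (Q (pos_re (- x))) (Q (pos_re (- 'i *: x))) (Q (pos_re ('i *: x))).

(** Independence of the chosen decomposition: apply [Q] to the sum identities of [nonneg_comb_inj]
    and use additivity on the cone. *)
Lemma cone_ext_comb a b c d :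
  linf_nonneg a -> linf_nonneg b -> linf_nonneg c -> linf_nonneg d ->
  cone_ext (comb a b c d) = comb (Q a) (Q b) (Q c) (Q d).
Proof.
move=> a0 b0 c0 d0.
have pr := pos_re_nonneg.
have [] := nonneg_comb_inj a0 b0 c0 d0 (pr _) (pr _) (pr _) (pr _)
  (comb_pos_re (comb a b c d)).
move=> /(congr1 Q) + /(congr1 Q); rewrite !QD// => e1 e2.
apply: linf_ext => n; rewrite /cone_ext /comb !linfE.
move: (congr1 (fun x => x n) e1) (congr1 (fun x => x n) e2); rewrite !linfE.
set q := Q (pos_re _) n; set p := Q (pos_re _) n.
set s := Q (pos_re _) n; set r := Q (pos_re _) n.
move=> {}e1 {}e2.
have -> : p = Q a n + q - Q b n by rewrite e1 addrK.
have -> : r = Q c n + s - Q d n by rewrite e2 addrK.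
ring.
Qed.

Lemma cone_ext_nonneg x : linf_nonneg x -> cone_ext x = Q x.
Proof.
move=> x0; have z0 : linf_nonneg (0 : linf R) by move=> n.
have Q0 : Q 0 = 0 by have := QZ (lexx 0) z0; rewrite !scale0r.
have {1}-> : x = comb x 0 0 0 by rewrite /comb !subr0 scaler0 addr0.
by rewrite cone_ext_comb// Q0 /comb !subr0 scaler0 addr0.
Qed.

Lemma cone_ext_linear : linear cone_ext.
Proof.
move=> l x y.
have pr := pos_re_nonneg.
pose m (r : R) := Num.max r 0.
have m0 r : 0 <= m r by rewrite le_max lexx orbT.
have mB (r : R) : r = m r - m (- r) by rewrite max0B.
have lE : l = (m (complex.Re l))%:C - (m (- complex.Re l))%:C
    + 'i * ((m (complex.Im l))%:C - (m (- complex.Im l))%:C).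
  by rewrite -!rmorphB/= -!mB {1}[l]complexE.
have i2 : 'i * 'i = -1 :> R[i] by rewrite -expr2 sqr_i.
move: lE; set l0 := m _; set l1 := m _; set l2 := m _; set l3 := m _ => lE.
(* Expansion of the product with i^2 = -1. Each term with a minus sign moves to the opposite
   component, so all coefficients stay nonnegative and [cone_ext_comb] applies. *)
have lxyE (x0 x1 x2 x3 y0 y1 y2 y3 : linf R) :
  l *: comb x0 x1 x2 x3 + comb y0 y1 y2 y3 =
  comb (l0%:C *: x0 + l1%:C *: x1 + l2%:C *: x3 + l3%:C *: x2 + y0)
       (l0%:C *: x1 + l1%:C *: x0 + l2%:C *: x2 + l3%:C *: x3 + y1)
       (l0%:C *: x2 + l1%:C *: x3 + l2%:C *: x0 + l3%:C *: x1 + y2)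
       (l0%:C *: x3 + l1%:C *: x2 + l2%:C *: x1 + l3%:C *: x0 + y3).
  apply: linf_ext => n; rewrite /comb !linfE lE. ring: i2.
rewrite [in LHS](comb_pos_re x) [in LHS](comb_pos_re y) lxyE.
rewrite cone_ext_comb; do ?[exact: pr | apply: linf_nonnegD | apply: linf_nonnegZ | exact: m0].
rewrite /cone_ext lxyE !QD ?QZ //;
  by do ?[exact: pr | apply: linf_nonnegD | apply: linf_nonnegZ | exact: m0].
Qed.

End Extension.

(** * Norm estimates and continuity of positive operators *)

Lemma linf_le_norm x y : (forall n, `|x n| <= `|y n|) -> `|x| <= `|y|.
Proof.
move=> xy; rewrite (linf_normE y); apply: linf_norm_leE => n.
by rewrite -linf_normE (le_trans (xy n))// linf_norm_geE.
Qed.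

Lemma pos_re_norm x : `|pos_re x| <= `|x|.
Proof.
apply: linf_le_norm => n; apply: le_trans (normc_ge_Re _).
rewrite ger0_norm; last exact: pos_re_nonneg.
by rewrite pos_reE lecR ge_max ler_norm normr_ge0.
Qed.

Lemma norm_i : `|'i| = 1 :> R[i].
Proof. by rewrite normc_def /= expr0n expr1n add0r sqrtr1. Qed.

Lemma comb_norm a b c d : `|comb a b c d| <= `|a| + `|b| + (`|c| + `|d|).
Proof.
rewrite /comb; apply: le_trans (ler_normD _ _) _.
rewrite normrZ norm_i mul1r; apply: lerD; exact: ler_normB.
Qed.

Lemma linear_comb P : linear P -> forall a b c d,
  P (comb a b c d) = comb (P a) (P b) (P c) (P d).
Proof.
move=> Plin a b c d.
by rewrite /comb (GRing.semilinear_linear Plin).2 (scalable_linear Plin) !(zmod_morphism_linear Plin).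
Qed.

(** With [e] the constant sequence 1, a nonnegative y satisfies y <= |y| e, hence P y <= |y| P e. A
    general x has four nonnegative parts of norm at most |x|, whence the factor 4 in the bound on
    balls. *)
Lemma linear_nonneg_continuous P : linear P ->
  (forall x, linf_nonneg x -> linf_nonneg (P x)) -> continuous P.
Proof.
move=> Plin P0.
have one_bd : (fun=> 1) \in @bounded_seq R.
  by apply/bounded_seqP; exists 1 => _; rewrite normr1.
pose e := Linf one_bd.
have Ppos y : linf_nonneg y -> `|P y| <= `|y| * `|P e|.
  move=> y0; rewrite (linf_normE y) (linf_normE (P e)) -rmorphM.
  apply: linf_norm_leE => n.
  have /P0/(_ n) : linf_nonneg ((complex.Re `|y|)%:C *: e - y).
    move=> k; rewrite !linfE mulr1 subr_ge0 -linf_normE.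
    by rewrite -[y k]ger0_norm ?linf_norm_geE.
  rewrite (zmod_morphism_linear Plin) (scalable_linear Plin) !linfE subr_ge0.
  rewrite (ger0_norm (P0 _ y0 n)) => /le_trans; apply; rewrite rmorphM/=.
  rewrite -!linf_normE ler_wpM2l//; apply: le_trans (linf_norm_geE _ n).
  by rewrite ger0_norm//; apply: P0 => k; exact: ler01.
pose mP := GRing.isLinear.Build R[i] (linf R) (linf R) *:%R P Plin.
pose f : {linear linf R -> linf R} := HB.pack P mP.
apply: (linear_bounded_continuous f).1.
apply: (bounded_funP f).1 => r; exists (r * `|P e| *+ 4) => x xr /=.
rewrite (comb_pos_re x) (linear_comb Plin).
have Pr z : `|z| <= `|x| -> linf_nonneg z -> `|P z| <= r * `|P e|.
  move=> zx z0; apply: le_trans (Ppos _ z0) _.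
  by rewrite ler_wpM2r// (le_trans zx).
apply: le_trans (comb_norm _ _ _ _) _.
rewrite !mulrS mulr0n addr0 addrA -!addrA.
do ?apply: lerD; apply: Pr; rewrite ?(le_trans (pos_re_norm _)) //.
all: try exact: pos_re_nonneg.
all: rewrite ?normrN ?normrZ ?normrN ?norm_i ?mul1r //.
Qed.

Lemma bounded_operator_bound T : bounded_operator T ->
  exists M : R, forall x, `|T x| <= M%:C * `|x|.
Proof.
move=> [Tlin Tcont].
pose mT := GRing.isLinear.Build R[i] (linf R) (linf R) *:%R T Tlin.
pose f : {linear linf R -> linf R} := HB.pack T mT.
have /(linear_boundedP f).1/pinfty_ex_gt0[r r0 fr] :=
  (linear_bounded_continuous f).2 Tcont.
exists (complex.Re r) => x; rewrite RRe_real ?gtr0_real//; exact: fr.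
Qed.

(** * Order intervals and Riesz decomposition *)

Definition order_itv x : set (linf R) :=
  [set y | linf_nonneg y /\ linf_nonneg (x - y)].

Lemma order_itv_norm x y : order_itv x y -> `|y| <= `|x|.
Proof.
move=> [y0 xy]; apply: linf_le_norm => n.
have yx : y n <= x n by rewrite -subr_ge0; exact: xy.
by rewrite !ger0_norm// (le_trans (y0 n)).
Qed.

Lemma order_itv0 x : linf_nonneg x -> order_itv x 0.
Proof. by move=> x0; split=> //; rewrite subr0. Qed.

Lemma order_itvxx x : linf_nonneg x -> order_itv x x.
Proof. by move=> x0; split=> //; rewrite subrr. Qed.

Lemma order_itvD x y a b :
  order_itv x a -> order_itv y b -> order_itv (x + y) (a + b).
Proof.
move=> [a0 xa] [b0 yb]; split; first exact: linf_nonnegD.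
by rewrite opprD addrACA; exact: linf_nonnegD.
Qed.

Lemma order_itvZ (r : R) x a :
  0 <= r -> order_itv x a -> order_itv (r%:C *: x) (r%:C *: a).
Proof. by move=> r0 [a0 xa]; split; rewrite -?scalerBr; exact: linf_nonnegZ. Qed.

Lemma riesz_decomposition x y z : linf_nonneg x -> linf_nonneg y ->
  order_itv (x + y) z -> exists a b, [/\ order_itv x a, order_itv y b & z = a + b].
Proof.
move=> x0 y0 [z0 xyz].
(* The first summand is the coordinatewise minimum of z and x. The order on [R[i]] is partial, but
   these entries are nonnegative, hence comparable. *)
have a_bd : (fun n => if z n <= x n then z n else x n) \in @bounded_seq R.
  apply/bounded_seqP; exists (complex.Re `|z| + complex.Re `|x|) => n.
  rewrite rmorphD/= -!linf_normE.
  by case: ifP => _; [rewrite ler_wpDr|rewrite ler_wpDl]; rewrite ?linf_norm_geE.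
pose a := Linf a_bd.
have aE n : a n = if z n <= x n then z n else x n by [].
exists a, (z - a); split; last by rewrite addrC subrK.
- split=> n; first by rewrite aE; case: ifP.
  by rewrite !linfE aE; case: ifPn => zx; rewrite ?subrr// subr_ge0.
- split=> n; rewrite !linfE aE; case: ifPn; rewrite ?subrr ?subr0//.
    by rewrite -real_ltNge ?ger0_real// subr_ge0 => /ltW.
  by move=> _; have := xyz n; rewrite !linfE opprB addrA [y n + _]addrC addrAC addrC.
Qed.

(** * The positive part of Re T on the cone *)

Lemma Re_le_norm (u : R[i]) (B : R) : `|u| <= B%:C -> `|complex.Re u| <= B.
Proof. by move=> uB; rewrite -lecR; apply: le_trans uB; exact: normc_ge_Re. Qed.

Lemma Re_realM (r : R) (u : R[i]) : complex.Re (r%:C * u) = r * complex.Re u.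
Proof. by case: u => a b /=; rewrite mul0r subr0. Qed.

Section PosPart.
Variable T : linf R -> linf R.
Hypothesis Tbd : bounded_operator T.

Let S x n : set R := [set complex.Re (T y n) | y in order_itv x].

(** The bound is uniform in the coordinate [n], so that the coordinatewise suprema again form a
    bounded sequence. *)
Lemma re_values_bounded x : exists B : R, forall n v, S x n v -> `|v| <= B.
Proof.
have [M TM] := bounded_operator_bound Tbd.
have M0 : 0 <= `|M| by [].
exists (`|M| * complex.Re `|x|) => n _ [y xy <-]; apply: Re_le_norm.
rewrite rmorphM/= -linf_normE; apply: le_trans (linf_norm_geE _ _) _.
apply: le_trans (TM y) _; apply: (@le_trans _ _ (`|M|%:C * `|y|)).
  by rewrite ler_wpM2r// lecR ler_norm.
by rewrite ler_wpM2l ?ler0c// order_itv_norm.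
Qed.

Lemma pos_part_bounded x : (fun n => (sup (S x n))%:C) \in @bounded_seq R.
Proof.
have [B SB] := re_values_bounded x.
apply/bounded_seqP; exists `|B| => n.
rewrite normc_def/= expr0n addr0 sqrtr_sqr lecR.
have [->|/set0P[v Sv]] := eqVneq (S x n) set0; first by rewrite sup0 normr0.
have SB' w : S x n w -> `|w| <= `|B| by move=> /SB/le_trans; apply; exact: ler_norm.
rewrite ler_norml; apply/andP; split.
  apply: (@le_trans _ _ v); first by have := SB' _ Sv; rewrite ler_norml => /andP[].
  apply: ub_le_sup => //; exists `|B| => w /SB'; exact/le_trans/ler_norm.
by apply: ge_sup; [exists v|move=> w /SB'; exact/le_trans/ler_norm].
Qed.

(* The Riesz-Kantorovich formula for the positive part of Re T. It is meaningful
   only for x >= 0: otherwise the order interval is empty and sup gives 0. *)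
Definition pos_part x : linf R := Linf (pos_part_bounded x).

Let has_supS x n : linf_nonneg x -> has_sup (S x n).
Proof.
move=> x0; split; first by exists (complex.Re (T 0 n)), 0 => //; exact: order_itv0.
have [B SB] := re_values_bounded x.
by exists B => w /SB; exact/le_trans/ler_norm.
Qed.

Lemma le_pos_part x y n : linf_nonneg x -> order_itv x y ->
  complex.Re (T y n) <= complex.Re (pos_part x n).
Proof. by move=> x0 xy; apply: ub_le_sup; [case: (has_supS n x0)|exists y]. Qed.

Let TD x y : T (x + y) = T x + T y.
Proof. exact: (GRing.semilinear_linear Tbd.1).2. Qed.

Let T0 : T 0 = 0.
Proof. by apply: (addrI (T 0)); rewrite -TD !addr0. Qed.

Let TZ (l : R[i]) x : T (l *: x) = l *: T x.
Proof. exact: (scalable_linear Tbd.1). Qed.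

Lemma pos_part_nonneg x : linf_nonneg x -> linf_nonneg (pos_part x).
Proof.
move=> x0 n; rewrite ler0c; have := le_pos_part n x0 (order_itv0 x0).
by rewrite T0.
Qed.

(** The values over the interval of x + y are exactly the sums of values over the two intervals, by
    Riesz decomposition one way and [order_itvD] the other; sup turns such sums into sums. *)
Lemma pos_partD x y : linf_nonneg x -> linf_nonneg y ->
  pos_part (x + y) = pos_part x + pos_part y.
Proof.
move=> x0 y0; apply: linf_ext => n; rewrite linfD -rmorphD/=; congr (_%:C).
rewrite -sup_sumE; [|exact: has_supS..]; congr sup; apply/seteqP; split.
  move=> _ [z /(riesz_decomposition x0 y0)[a [b [xa yb ->]]] <-].
  by exists (complex.Re (T a n)); [exists a|exists (complex.Re (T b n));
    [exists b|rewrite TD linfD raddfD]].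
move=> _ [_ [a xa <-] [_ [b yb <-] <-]]; exists (a + b); first exact: order_itvD.
by rewrite TD linfD raddfD.
Qed.

(** Scaling an interval gives one inequality for every positive factor; using it for [r] at x and
    for [r^-1] at rx gives equality. For r = 0, additivity forces the value at 0 to vanish. *)
Lemma pos_partZ (r : R) x : 0 <= r -> linf_nonneg x ->
  pos_part (r%:C *: x) = r%:C *: pos_part x.
Proof.
have half (s : R) y n : 0 < s -> linf_nonneg y ->
    s * complex.Re (pos_part y n) <= complex.Re (pos_part (s%:C *: y) n).
  move=> s0 y0; rewrite mulrC -ler_pdivlMr//.
  apply: ge_sup; first by case: (has_supS n y0).
  move=> _ [z yz <-]; rewrite ler_pdivlMr// mulrC.
  have := le_pos_part n (linf_nonnegZ (ltW s0) y0) (order_itvZ (ltW s0) yz).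
  by rewrite TZ linfZ Re_realM.
rewrite le_eqVlt => /predU1P[<- x0|r0 x0].
  rewrite !scale0r; have z0 : linf_nonneg (0 : linf R) by move=> n.
  by apply: (addrI (pos_part 0)); rewrite -pos_partD// !addr0.
apply: linf_ext => n; rewrite linfZ -rmorphM/=; congr (_%:C).
apply/le_anti; rewrite (half r x n r0 x0) andbT mulrC -ler_pdivrMr// mulrC.
have rx0 := linf_nonnegZ (ltW r0) x0.
have := half r^-1 _ n _ rx0; rewrite invr_gt0 r0 => /(_ isT).
by rewrite scalerA -rmorphM/= mulVf ?gt_eqF// scale1r.
Qed.

(** The identity is stated on the cone because Re T is only real linear, while [P1] and [P2] are
    complex linear. *)
Lemma re_difference_of_positive : exists P1 P2 : linf R -> linf R,
  [/\ positive_operator P1, positive_operator P2 &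
   forall x n, linf_nonneg x -> (complex.Re (T x n))%:C = P1 x n - P2 x n].
Proof.
have pos_op Q : (forall x y, linf_nonneg x -> linf_nonneg y -> Q (x + y) = Q x + Q y) ->
    (forall (r : R) x, 0 <= r -> linf_nonneg x -> Q (r%:C *: x) = r%:C *: Q x) ->
    (forall x, linf_nonneg x -> linf_nonneg (Q x)) -> positive_operator (cone_ext Q).
  move=> QD QZ Q0; have ext0 x : linf_nonneg x -> linf_nonneg (cone_ext Q x).
    by move=> x0; rewrite cone_ext_nonneg//; exact: Q0.
  split => //; split; first exact: cone_ext_linear.
  by apply: linear_nonneg_continuous => //; exact: cone_ext_linear.
have reT_bd x : (fun n => (complex.Re (T x n))%:C) \in @bounded_seq R.
  apply/bounded_seqP; exists (complex.Re `|T x|) => n.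
  rewrite normc_def/= expr0n addr0 sqrtr_sqr lecR; apply: Re_le_norm.
  by rewrite -linf_normE linf_norm_geE.
pose reT x := Linf (reT_bd x).
have reTE x n : reT x n = (complex.Re (T x n))%:C by [].
(* Nonnegative on the cone, since x belongs to its own order interval and so Re T x is one of the
   values under the supremum. *)
pose Q x := pos_part x - reT x.
have QD x y : linf_nonneg x -> linf_nonneg y -> Q (x + y) = Q x + Q y.
  move=> x0 y0; rewrite /Q pos_partD//; apply: linf_ext => n.
  by rewrite !linfE !reTE TD linfD raddfD rmorphD/=; ring.
have QZ (r : R) x : 0 <= r -> linf_nonneg x -> Q (r%:C *: x) = r%:C *: Q x.
  move=> r0 x0; rewrite /Q pos_partZ//; apply: linf_ext => n.
  by rewrite !linfE !reTE TZ linfZ Re_realM rmorphM/= mulrBr.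
have Q0 x : linf_nonneg x -> linf_nonneg (Q x).
  move=> x0 n; rewrite linfD linfN reTE subr_ge0 lecR.
  exact: (le_pos_part n x0 (order_itvxx x0)).
exists (cone_ext pos_part), (cone_ext Q); split.
- by apply: pos_op; [exact: pos_partD|exact: pos_partZ|exact: pos_part_nonneg].
- exact: pos_op.
- move=> x n x0; rewrite !cone_ext_nonneg//; [|exact: pos_partD|exact: pos_partZ].
  by rewrite linfD linfN opprB addrC subrK reTE.
Qed.

End PosPart.

(** * Regularity of bounded operators *)

Lemma bounded_operatorZ (l : R[i]) T :
  bounded_operator T -> bounded_operator (fun x => l *: T x).
Proof.
move=> [Tlin Tcont]; split.
  by move=> a x y; rewrite Tlin scalerDr !scalerA mulrC.
by move=> x; exact: (continuous_comp (Tcont x) (@scaler_continuous _ _ l _)).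
Qed.

Lemma bounded_operator_regular T : bounded_operator T -> regular_operator T.
Proof.
move=> Tbd; split=> //.
have [P1 [P2 [P1p P2p TE]]] := re_difference_of_positive Tbd.
(* Re (-iT) = Im T, so this splits the imaginary part. *)
have [P3 [P4 [P3p P4p iTE]]] :=
  re_difference_of_positive (bounded_operatorZ (- 'i) Tbd).
have TE0 x : linf_nonneg x -> T x = comb (P1 x) (P2 x) (P3 x) (P4 x).
  move=> x0; apply: linf_ext => n.
  rewrite /comb !linfE -TE// -iTE// linfZ.
  rewrite ?opprK; case: (T x n) => u v; apply/eqP; rewrite eq_complex /=.
  by apply/andP; split; apply/eqP; ring.
have L P : positive_operator P -> linear P by case=> -[].
(* Both sides are linear, so agreement on the cone carries over to the four nonnegative parts of any
   x. *)
have {}TE0 x : T x = comb (P1 x) (P2 x) (P3 x) (P4 x).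
  have [Tlin _] := Tbd.
  rewrite (comb_pos_re x) (linear_comb Tlin) (linear_comb (L _ P1p)).
  rewrite (linear_comb (L _ P2p)) (linear_comb (L _ P3p)) (linear_comb (L _ P4p)).
  rewrite !TE0; try exact: pos_re_nonneg.
  by apply: linf_ext => n; rewrite /comb !linfE; ring.
exists 4, (tnth [tuple 1; -1; 'i; - 'i]), (tnth [tuple P1; P2; P3; P4]); split.
  move=> i; rewrite (tnth_nth P1); case: i => -[|[|[|[|]]]] //.
move=> x; rewrite TE0 !big_ord_recl big_ord0 !(tnth_nth 0, tnth_nth P1) /=.
by rewrite /comb scale1r scaleN1r scaleNr scalerBr addr0 -!addrA.
Qed.

(** * The Cesàro operator and its spectra *)

Lemma cesaro_opE x n : cesaro_op x n = n.+1%:R^-1 * \sum_(k < n.+1) x k.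
Proof. by []. Qed.

Lemma cesaro_op_positive : positive_operator (@cesaro_op R).
Proof.
have C0 x : linf_nonneg x -> linf_nonneg (cesaro_op x).
  move=> x0 n; rewrite cesaro_opE mulr_ge0 ?invr_ge0 ?ler0n//.
  by apply: sumr_ge0 => k _; exact: x0.
have Clin : linear (@cesaro_op R).
  move=> l x y; apply: linf_ext => n; rewrite linfD linfZ !cesaro_opE.
  under eq_bigr do rewrite linfD linfZ.
  by rewrite big_split/= -mulr_sumr mulrDr mulrCA.
by split=> //; split=> //; exact: linear_nonneg_continuous.
Qed.

End Linf.

Theorem proposition4p3 (R : realType) :
  bounded_operator (@cesaro_op R) /\
  positive_operator (@cesaro_op R) /\
  order_spectrum (@cesaro_op R) = spectrum (@cesaro_op R).
Proof.
have [Cbd _] := cesaro_op_positive R.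
split=> //; split; first exact: cesaro_op_positive.
(* Both spectra are [spectrum_in] of the same operator, so equality of the two algebras suffices;
   regular operators are bounded by definition. *)
congr (spectrum_in _ _); apply/seteqP; split=> T; first by case.
exact: bounded_operator_regular.
Qed.
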